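(* Let $q$ be a prime power, $n\geq 2$, $e=(q^n-1)/(q-1)$, $f=q-1$, and let $\alpha$ be a primitive element of $\mathrm{GF}(q^n)$. Then the cyclotomic numbers of order $e$ over $\mathrm{GF}(q^n)$ are as follows: (i) $(0,0)_e=f-1$. (ii) $(0,i)_e=(i,0)_e=(i,i)_e=0$ for all $1\leq i\leq e-1$. (iii) For $1\leq j\leq e-1$ and $0\leq i\leq e-1$ with $i\notin\{0,j\}$, $(i,j)_e$ equals $1$ if $i\in S_j\setminus\{0,j\}$ and $0$ otherwise. (iv) For $1\leq i,j\leq e-1$ with $i\neq j$, $(i,j)_e=1$ if $i$ and $j$ both belong to $S_h$ for some $0<h<e$, and $(i,j)_e=0$ otherwise.
   Context: With $q^n=ef+1$, the cyclotomic classes of order $e$ are $C_i^e=\{\alpha^{es+i}:0\leq s\leq f-1\}$, $0\leq i\leq e-1$. The cyclotomic number $(i,j)_e$, $0\leq i,j\leq e-1$, is the number of pairs $(z_i,z_j)\in C_i^e\times C_j^e$ with $z_i=z_j-1$. For $1\leq k\leq e-1$, $S_k=\{j:\alpha^j\in\operatorname{Span}(1,\alpha^k),\ 0\leq j\leq e-1\}$, the span being over $\mathrm{GF}(q)$. *)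

(* Defs.v *)
From HB Require Import structures.
From mathcomp Require Import all_boot all_order all_algebra all_field.

Set Implicit Arguments.
Unset Strict Implicit.
Unset Printing Implicit Defensive.

Import GRing.Theory.
Local Open Scope ring_scope.

Section Cyclotomy.

(* Meaningful when alpha is a primitive element of K and #|K| = e * f + 1. *)
Variables (K : finFieldType) (alpha : K) (e f : nat).

Definition cyclotomic_class (i : nat) : {set K} :=
  [set alpha ^+ (e * s + i) | s : 'I_f].

Definition cyclotomic_number (i j : nat) : nat :=
  #|[set z in setX (cyclotomic_class i) (cyclotomic_class j)
       | z.1 == z.2 - 1]|.

End Cyclotomy.

Definition span_exponents (F : fieldType) (L : fieldExtType F)
    (alpha : L) (e k : nat) : pred nat :=
  [pred j | (j < e)%N & alpha ^+ j \in span [:: 1; alpha ^+ k]].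

(* Main.v *)
Require Import Defs.
From HB Require Import structures.
From mathcomp Require Import all_boot all_order all_algebra all_field.

(** Since [e = (q^n - 1) / (q - 1)], the power [alpha ^+ e] has order [q - 1]
    and generates the multiplicative group of [F], seen inside [L].  So the
    cyclotomic class of [i] is the punctured line [{a *: alpha ^+ i | a != 0}]:
    the classes of order [e] are the points of the projective space of [L] over
    [F], and [alpha ^+ i], [alpha ^+ j] are independent over [F] as soon as
    [i <> j] below [e] ([prim_powers_independent]).

    Therefore the cyclotomic number [(i, j)] counts the pairs of nonzero scalars
    [(a, b)] with [a *: alpha ^+ i = b *: alpha ^+ j - 1]
    ([cyclotomic_number_scalars]), an [F]-linear relation between
    [1 = alpha ^+ 0], [alpha ^+ i] and [alpha ^+ j].  When exactly two of these
    three points coincide, independence of two distinct points forbids such a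
    relation.  When all three coincide, the relation reads [a = b - 1] in [F],
    with [q - 2] solutions.  When they are distinct, a solution
    exhibits [alpha ^+ i] on the line through [1] and [alpha ^+ j]; conversely
    the coordinates of [alpha ^+ i] in the basis [1, alpha ^+ j] are unique and
    nonzero and determine [(a, b)], so there is exactly one solution
    ([cyclotomic_number_line]).

    Finally, if [i] and [j] lie on one line through [1] and [alpha ^+ h], then
    that line is also the one through [1] and [alpha ^+ j]
    ([mem_span_exchange]), so the last case reduces to the previous one. *)

Set Implicit Arguments.
Unset Strict Implicit.
Unset Printing Implicit Defensive.

Import GRing.Theory.
Local Open Scope ring_scope.

(** * Linear algebra and scalars of a finite field *)

Lemma scaler_inj_scalar (F : fieldType) (V : lmodType F) (v : V) :
  v != 0 -> injective ( *:%R^~ v).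
Proof.
move=> v_neq0 a b /eqP; rewrite -subr_eq0 -scalerBl scaler_eq0.
by rewrite (negPf v_neq0) orbF subr_eq0 => /eqP.
Qed.

Lemma span_pairP (F : fieldType) (V : vectType F) (u v w : V) :
  reflect (exists a b, w = a *: u + b *: v) (w \in span [:: u; v]).
Proof.
rewrite span_cons span_seq1.
apply: (iffP memv_addP) => [[_ /vlineP[a ->] [_ /vlineP[b ->] ->]]|[a [b ->]]].
  by exists a, b.
exists (a *: u); first by rewrite rpredZ ?memv_line.
by exists (b *: v) => //; rewrite rpredZ ?memv_line.
Qed.

(** Steinitz exchange on a plane: a vector of [span (u, v)] off the line of [u]
    can replace [v]. *)
Lemma mem_span_exchange (F : fieldType) (V : vectType F) (u v w x : V) :
  w \notin <[u]>%VS -> w \in span [:: u; v] -> x \in span [:: u; v] ->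
  x \in span [:: u; w].
Proof.
move=> wNu /span_pairP[a [b wE]] /span_pairP[c [d ->]].
have b_neq0 : b != 0.
  by apply: contraNneq wNu => b0; rewrite wE b0 scale0r addr0 rpredZ ?memv_line.
have vE : v = b^-1 *: (w - a *: u).
  by rewrite wE addrC addKr scalerA mulVf // scale1r.
have uS : u \in span [:: u; w] by rewrite memv_span ?mem_head.
have wS : w \in span [:: u; w] by rewrite memv_span ?inE ?eqxx ?orbT.
by rewrite vE rpredD ?rpredZ ?rpredB ?rpredZ.
Qed.

Lemma scalar_expf_card (F : finFieldType) (A : algType F) (a : F) :
  a != 0 -> (a%:A : A) ^+ #|F|.-1 = 1.
Proof.
move=> a_neq0; rewrite exprZn expr1n -[X in X *: _](mulfK a_neq0) -exprSr.
by rewrite prednK ?expf_card ?mulfV ?scale1r //; apply/card_gt0P; exists 0.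
Qed.

(** The elements of [F] already provide all the roots of [X^#|F| - X]. *)
Lemma scalar_of_unity_root (F : finFieldType) (L : fieldExtType F) (x : L) :
  x ^+ #|F|.-1 = 1 -> exists2 a : F, a != 0 & x = a%:A.
Proof.
move=> x_unity; have x_fix : x ^+ #|F| = x.
  rewrite -(@prednK #|F|) ?exprS ?x_unity ?mulr1 //.
  by apply/card_gt0P; exists 0.
have : root (map_poly (in_alg L) ('X^#|F| - 'X)) x.
  by rewrite rmorphB /= map_polyXn map_polyX rootE !hornerE x_fix subrr.
rewrite finField_genPoly map_prod_XsubC -(big_map (in_alg L) xpredT
  (fun y => 'X - y%:P)) root_prod_XsubC => /mapP[a _ xE].
exists a => //; apply: contra_eq_neq x_unity => a0.
by rewrite xE a0 rmorph0 expr0n -subn1 subn_eq0 leqNgt finNzRing_gt1 eq_sym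
  oner_neq0.
Qed.

(** * Powers of a primitive root as points of a projective space *)

Lemma prim_root_exp_neq0 (R : idomainType) (m : nat) (z : R) :
  m.-primitive_root z -> forall k, z ^+ k != 0.
Proof.
move=> prim_z k; rewrite expf_neq0 // (prim_root_eq0 prim_z).
by rewrite -lt0n (prim_order_gt0 prim_z).
Qed.

(** The nonzero scalar [a] has order dividing that of [alpha ^+ e], so it is a
    power of it. *)
Lemma prim_powers_proportional (F : finFieldType) (L : fieldExtType F) (e : nat)
    (alpha : L) (i : nat) (a : F) :
  (e * #|F|.-1).-primitive_root alpha -> a != 0 ->
  exists s : 'I_#|F|.-1, a *: alpha ^+ i = alpha ^+ (e * s + i).
Proof.
move=> prim_alpha a_neq0; have e_gt0 : (0 < e)%N.
  by move: (prim_order_gt0 prim_alpha); rewrite muln_gt0 => /andP[].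
have prim_e : #|F|.-1.-primitive_root (alpha ^+ e).
  have := exp_prim_root prim_alpha e.
  by rewrite (gcdn_idPl (dvdn_mulr _ (dvdnn e))) mulKn.
have [s aE] := prim_rootP prim_e (scalar_expf_card L a_neq0).
by exists s; rewrite exprD exprM -aE -scalerAl mul1r.
Qed.

(** Two exponents below [e] that gave proportional powers would differ by a
    multiple of [e] modulo the order of [alpha], itself a multiple of [e]. *)
Lemma prim_powers_independent (F : finFieldType) (L : fieldExtType F) (e : nat)
    (alpha : L) (i j : nat) (a b : F) :
  (e * #|F|.-1).-primitive_root alpha -> (i < e)%N -> (j < e)%N -> i != j ->
  a *: alpha ^+ i = b *: alpha ^+ j -> a = 0 /\ b = 0.
Proof.
move=> prim_alpha lt_ie lt_je i_neq_j ab_eq.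
have alpha_neq0 := prim_root_exp_neq0 prim_alpha.
have scale_eq0 c k : c *: alpha ^+ k = 0 -> c = 0.
  by move/eqP; rewrite scaler_eq0 (negPf (alpha_neq0 k)) orbF => /eqP.
have [a0|a_neq0] := eqVneq a 0.
  by split=> //; apply: (scale_eq0 _ j); rewrite -ab_eq a0 scale0r.
have [b0|b_neq0] := eqVneq b 0.
  by split=> //; apply: (scale_eq0 _ i); rewrite ab_eq b0 scale0r.
have [s aE] := prim_powers_proportional i prim_alpha a_neq0.
have [t bE] := prim_powers_proportional j prim_alpha b_neq0.
move/eqP: ab_eq; rewrite aE bE (eq_prim_root_expr prim_alpha).
move=> /eqP/(congr1 (modn^~ e)); rewrite !modn_dvdm ?dvdn_mulr //.
rewrite !(mulnC e) !modnMDl !modn_small // => ij.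
by rewrite ij eqxx in i_neq_j.
Qed.

(** * Cyclotomic numbers as counts of linear relations *)

(** The powers [alpha ^+ (e * s)], [s < q - 1], run over all nonzero scalars,
    because they are the roots of unity of order dividing [q - 1]. *)
Lemma cyclotomic_classP (F : finFieldType) (L : fieldExtType F) (e : nat)
    (alpha : finvect_type L) (i : nat) (z : finvect_type L) :
  (e * #|F|.-1).-primitive_root alpha ->
  reflect (exists2 a : F, a != 0 & z = a *: alpha ^+ i)
          (z \in cyclotomic_class alpha e #|F|.-1 i).
Proof.
move=> prim_alpha; apply: (iffP imsetP) => [[s _ ->]|[a a_neq0 ->]].
  have [|a a_neq0 aE] := @scalar_of_unity_root F _ (alpha ^+ (e * s)).
    by rewrite -exprM mulnAC exprM (prim_expr_order prim_alpha) expr1n.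
  by exists a => //; rewrite exprD aE -scalerAl mul1r.
have [s ->] := prim_powers_proportional i prim_alpha a_neq0.
by exists s.
Qed.

Lemma cyclotomic_number_scalars (F : finFieldType) (L : fieldExtType F)
    (e : nat) (alpha : finvect_type L) (i j : nat) :
  (e * #|F|.-1).-primitive_root alpha ->
  cyclotomic_number alpha e #|F|.-1 i j =
  #|[set p : F * F | [&& p.1 != 0, p.2 != 0
      & p.1 *: alpha ^+ i == p.2 *: alpha ^+ j - 1]]|.
Proof.
move=> prim_alpha; have alpha_neq0 := prim_root_exp_neq0 prim_alpha.
pose g (p : F * F) := (p.1 *: alpha ^+ i, p.2 *: alpha ^+ j).
have g_inj : injective g.
  by move=> [a b] [c d] [/(scaler_inj_scalar (alpha_neq0 i)) ->
    /(scaler_inj_scalar (alpha_neq0 j)) ->].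
rewrite -(card_imset _ g_inj) /cyclotomic_number; apply: eq_card => -[x y].
rewrite !inE /=; apply/idP/imsetP => [|[[a b] + [-> ->]]].
  case/andP=> /andP[/(cyclotomic_classP _ _ prim_alpha)[a a_neq0 ->]].
  move=> /(cyclotomic_classP _ _ prim_alpha)[b b_neq0 ->] eq_ab.
  by exists (a, b); rewrite // inE a_neq0 b_neq0.
rewrite inE => /and3P[/= a_neq0 b_neq0 ->]; rewrite andbT; apply/andP.
by split; apply/(cyclotomic_classP _ _ prim_alpha); [exists a|exists b].
Qed.

Lemma cyclotomic_number_coincident (F : finFieldType) (L : fieldExtType F)
    (e : nat) (alpha : finvect_type L) (i : nat) :
  (e * #|F|.-1).-primitive_root alpha -> (0 < i < e)%N ->
  let cyc := cyclotomic_number alpha e #|F|.-1 in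
  [/\ cyc 0 i = 0, cyc i 0 = 0 & cyc i i = 0]%N.
Proof.
move=> prim_alpha /andP[i_gt0 lt_ie] cyc.
have e_gt0 := ltn_trans i_gt0 lt_ie.
have indep a b : a *: alpha ^+ 0 = b *: alpha ^+ i -> a = 0 /\ b = 0.
  by apply: (prim_powers_independent prim_alpha) => //; rewrite eq_sym -lt0n.
have cyc_eq0 k l : (forall a b : F, a != 0 -> b != 0 ->
    a *: alpha ^+ k = b *: alpha ^+ l - 1 -> False) -> cyc k l = 0%N.
  move=> no_rel; rewrite /cyc (cyclotomic_number_scalars _ _ prim_alpha).
  apply/eqP; rewrite cards_eq0 -subset0; apply/subsetP=> -[a b].
  by rewrite inE /= => /and3P[a_neq0 b_neq0 /eqP/no_rel]; case.
split; apply: cyc_eq0 => a b a_neq0 b_neq0 eq_ab.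
- have [|_ /eqP] := indep (a + 1) b; last by rewrite (negPf b_neq0).
  by rewrite scalerDl eq_ab expr0 scale1r subrK.
- have [|_ /eqP] := indep (b - 1) a; last by rewrite (negPf a_neq0).
  by rewrite scalerBl eq_ab expr0 scale1r.
have [|/eqP] := indep 1 (b - a); last by rewrite oner_eq0.
by rewrite scalerBl eq_ab expr0 scale1r opprB addrC subrK.
Qed.

(** The relation writes [alpha ^+ i] with coordinates [(- a^-1, a^-1 * b)] in
    the basis [1, alpha ^+ j].  These are unique, and nonzero because [i] is
    neither [0] nor [j], so they correspond to exactly one admissible
    [(a, b)]. *)
Lemma cyclotomic_number_line (F : finFieldType) (L : fieldExtType F) (e : nat)
    (alpha : finvect_type L) (i j : nat) :
  (e * #|F|.-1).-primitive_root alpha -> (0 < i < e)%N -> (0 < j < e)%N ->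
  i != j ->
  cyclotomic_number alpha e #|F|.-1 i j =
  (alpha ^+ i \in span [:: 1; alpha ^+ j]).
Proof.
move=> prim_alpha /andP[i_gt0 lt_ie] /andP[j_gt0 lt_je] i_neq_j.
have e_gt0 := ltn_trans i_gt0 lt_ie.
rewrite (cyclotomic_number_scalars _ _ prim_alpha).
case: span_pairP => [[x [y aiE]]|not_in_span]; last first.
  apply/eqP; rewrite cards_eq0 -subset0; apply/subsetP=> -[a b].
  rewrite !inE /= => /and3P[a_neq0 _ /eqP eq_ab]; case: not_in_span.
  exists (- a^-1), (a^-1 * b).
  rewrite -[LHS]scale1r -(mulVf a_neq0) -scalerA eq_ab scalerBr scalerA.
  by rewrite scaleNr addrC.
have x_neq0 : x != 0.
  apply/eqP=> x0; have [|/eqP] := @prim_powers_independent _ _ _ _ i j 1 y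
    prim_alpha lt_ie lt_je i_neq_j.
    by rewrite scale1r aiE x0 scale0r add0r.
  by rewrite oner_eq0.
have y_neq0 : y != 0.
  apply/eqP=> y0; have [||/eqP] := @prim_powers_independent _ _ _ _ i 0 1 x
    prim_alpha lt_ie e_gt0.
  - by rewrite -lt0n.
  - by rewrite scale1r aiE y0 scale0r addr0 expr0.
  by rewrite oner_eq0.
(* Substituting alpha ^+ i = x + y alpha ^+ j, the relation asks for
   a x = -1 and a y = b. *)
apply/eqP/cards1P; exists (- x^-1, - x^-1 * y); apply/setP=> -[a b].
rewrite !inE /= aiE; apply/and3P/eqP => [[_ _ /eqP eq_ab]|[-> ->]].
  have [||ax ab] := @prim_powers_independent _ _ _ _ 0 j (a * x + 1) (b - a * y)
    prim_alpha e_gt0 lt_je.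
  - by rewrite eq_sym -lt0n.
  - rewrite expr0 scalerDl scalerBl scale1r -[b *: _](subrK 1) -eq_ab.
    by rewrite scalerDr !scalerA addrAC addrK.
  have aE : a = - x^-1.
    apply: (mulIf x_neq0); rewrite mulNr mulVf //.
    by apply/eqP; rewrite -addr_eq0 ax.
  by move/eqP: ab; rewrite subr_eq0 => /eqP ->; rewrite aE.
have xV_neq0 : - x^-1 != 0 by rewrite oppr_eq0 invr_eq0.
split=> //; first by rewrite mulf_neq0.
by rewrite scalerDr !scalerA mulNr mulVf // scaleN1r addrC.
Qed.

Lemma cyclotomic_number00 (F : finFieldType) (L : fieldExtType F) (e : nat)
    (alpha : finvect_type L) :
  (e * #|F|.-1).-primitive_root alpha ->
  cyclotomic_number alpha e #|F|.-1 0 0 = #|F|.-2.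
Proof.
move=> prim_alpha; rewrite (cyclotomic_number_scalars _ _ prim_alpha).
pose shift (b : F) := (b - 1, b).
have shift_inj : injective shift by move=> b c [].
(* The relation is a = b - 1 in F, where b = 1 gives a = 0 and shift 0 is the
   pair with b = 0. *)
rewrite (_ : [set p | _] = shift @: [set~ 1] :\ shift 0); last first.
  apply/setP=> -[a b]; rewrite !inE /= expr0.
  rewrite -{3}(scale1r (1 : finvect_type L)) -scalerBl.
  rewrite (inj_eq (scaler_inj_scalar (oner_neq0 _))).
  apply/and3P/andP => [[a_neq0 b_neq0 /eqP aE]|[+ /imsetP[c + abE]]].
    split; first by apply: contraNneq b_neq0 => -[_ ->].
    by apply/imsetP; exists b; rewrite ?inE -1?subr_eq0 -?aE // /shift -aE.
  rewrite !inE abE (inj_eq shift_inj) => c_neq0 c_neq1; case: abE => -> ->.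
  by rewrite subr_eq0 c_neq1 c_neq0.
have := cardsD1 (shift 0) (shift @: [set~ 1]).
rewrite mem_imset // !inE eq_sym oner_neq0 card_imset // cardsC1.
by move=> ->.
Qed.

(* F is GF(q) and finvect_type L, the fieldExtType L with its canonical finite
   field structure, is GF(q^n). *)
Theorem theorem3p4 (F : finFieldType) (L : fieldExtType F) (q n e f : nat)
    (alpha : finvect_type L)
    (hq : #|F| = q) (hqn : #|finvect_type L| = (q ^ n)%N) (hn : (2 <= n)%N)
    (he : e = ((q ^ n - 1) %/ (q - 1))%N) (hf : f = (q - 1)%N)
    (halpha : (q ^ n - 1).-primitive_root alpha) :
  let cyc i j := cyclotomic_number alpha e f i j in
  let S k := span_exponents alpha e k in
  [/\ cyc 0%N 0%N = (f - 1)%N,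
      forall i : nat, (1 <= i <= e - 1)%N ->
        [/\ cyc 0%N i = 0%N, cyc i 0%N = 0%N & cyc i i = 0%N],
      forall i j : nat, (1 <= j <= e - 1)%N -> (0 <= i <= e - 1)%N ->
        i != 0%N -> i != j ->
        cyc i j = (if [&& i \in S j, i != 0%N & i != j] then 1%N else 0%N)
    & forall i j : nat, (1 <= i <= e - 1)%N -> (1 <= j <= e - 1)%N -> i != j ->
        ((exists h : nat, [/\ (0 < h < e)%N, i \in S h & j \in S h]) ->
          cyc i j = 1%N) /\
        (~ (exists h : nat, [/\ (0 < h < e)%N, i \in S h & j \in S h]) ->
          cyc i j = 0%N)].
Proof.
have card_F : #|F|.-1 = f by rewrite hf -hq subn1.
have efE : (q ^ n - 1 = e * #|F|.-1)%N.
  by rewrite he hq !subn1 divnK // dvdn_pred_predX.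
rewrite efE in halpha; rewrite -card_F => cyc S.
have range k : (1 <= k <= e - 1)%N = (0 < k < e)%N.
  by case: e {he halpha efE cyc S} => [|e']; rewrite ?subn1 //= !leqn0; case: k.
have memS h k :
    (k \in S h) = (k < e)%N && (alpha ^+ k \in span [:: 1; alpha ^+ h]).
  by [].
have cyc_line i j : (0 < i < e)%N -> (0 < j < e)%N -> i != j ->
    cyc i j = (i \in S j).
  move=> hi hj i_neq_j; rewrite /cyc cyclotomic_number_line // memS.
  by case/andP: hi => _ ->.
split.
- by rewrite /cyc cyclotomic_number00 // subn1.
- by move=> i; rewrite range; apply: cyclotomic_number_coincident.
- move=> i j; rewrite range => hj /andP[_ le_ie] i_neq0 i_neq_j.
  by rewrite i_neq0 i_neq_j !andbT cyc_line // -range lt0n i_neq0.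
move=> i j; rewrite !range => hi hj i_neq_j; rewrite cyc_line //.
have [lt_ie lt_je] : (i < e)%N /\ (j < e)%N by case/andP: hi; case/andP: hj.
split=> [[h [_ iSh jSh]]|not_coline].
  have aj_notin : alpha ^+ j \notin <[1]>%VS.
    apply/vlineP=> -[c ajE]; case/andP: hj => j_gt0 _.
    have [||/eqP] := @prim_powers_independent _ _ _ _ j 0 1 c halpha lt_je
      (ltn_trans j_gt0 lt_je); last by rewrite oner_eq0.
    - by rewrite -lt0n.
    - by rewrite scale1r expr0.
  case/andP: iSh jSh => _ iSh /andP[_ jSh].
  by rewrite memS lt_ie (mem_span_exchange aj_notin jSh iSh).
case iSj: (i \in S j) => //; case: not_coline; exists j; split=> //.
by rewrite memS lt_je memv_span // !inE eqxx orbT.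
Qed.
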